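(* Let $(V,\varphi_V)$ and $(W,\varphi_W)$ be pointwise finite dimensional (PFD) persistence modules such that $(V,W)$ are $(\tau,\sigma)$-interleaved. Let $\mathcal{X}\colon\mathbf{PD}(V)\nrightarrow\mathbf{PD}(W)$ be a matching with property (P) (see context; such a matching exists by the generalized algebraic stability theorem). If $\mathcal{X}([b,d,i])=[b',d',i']$, then $$\tau^\star(b')\le b,\quad\tau^\star(d')\le d,\quad\sigma^\star(b)\le\tau^\uparrow\circ\tau^\star(b'),\quad\sigma^\star(d)\le\tau^\uparrow\circ\tau^\star(d').$$ Moreover, if the maps $\tau$ and $\sigma$ are bijections, then these inequalities reduce to $$\tau^\star(b')\le b,\quad\tau^\star(d')\le d,\quad\sigma^\star(b)\le b',\quad\sigma^\star(d)\le d',$$ and if $[b,d,i]\in\mathbf{PD}(V)$ is unmatched then it is $(\sigma\circ\tau)$-trivial, and if $[b',d',i']\in\mathbf{PD}(W)$ is unmatched then it is $(\tau\circ\sigma)$-trivial.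
   Context: Fix a field $\mathsf{k}$. A persistence module $V=(V,\varphi_V)$ is a family of $\mathsf{k}$-vector spaces $\{V_t\}_{t\in\mathbb{R}}$ with linear maps $\varphi_V(s,t)\colon V_s\to V_t$ for $s\le t$ such that $\varphi_V(t,t)=\mathrm{id}$ and $\varphi_V(s,t)\circ\varphi_V(r,s)=\varphi_V(r,t)$ for $r\le s\le t$. It is PFD if every $V_t$ is finite-dimensional. A morphism $\phi\colon V\to W$ is a family of linear maps $\phi_t\colon V_t\to W_t$ with $\phi_t\circ\varphi_V(s,t)=\varphi_W(s,t)\circ\phi_s$ for $s\le t$. Interleavings: a translation map is a monotone (non-decreasing) $\sigma\colon\mathbb{R}\to\mathbb{R}$ with $x\le\sigma(x)$ for all $x$. A translation pair is a pair $(\tau,\sigma)$ of monotone functions $\mathbb{R}\to\mathbb{R}$ such that $\tau\circ\sigma$ and $\sigma\circ\tau$ are translation maps. For $\sigma$ monotone, $V(\sigma)_t=V_{\sigma(t)}$ with $\varphi_{V(\sigma)}(s,t)=\varphi_V(\sigma(s),\sigma(t))$; for a morphism $\phi$, $\phi(\sigma)_t=\phi_{\sigma(t)}$. For a translation pair $(\tau,\sigma)$, $(V,W)$ is $(\tau,\sigma)$-interleaved if there are morphisms $\phi\colon V\to W(\tau)$, $\psi\colon W\to V(\sigma)$ with $\psi(\tau)_t\circ\phi_t=\varphi_V(t,(\sigma\circ\tau)(t))$ and $\phi(\sigma)_t\circ\psi_t=\varphi_W(t,(\tau\circ\sigma)(t))$ for all $t\in\mathbb{R}$. Decorated points: $\mathbb{E}=\mathbb{R}\times\{-,+\}\cup\{-\infty,\infty\}$,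 with $t^\pm=(t,\pm)$, ordered lexicographically with $-<+$, minimum $-\infty$, maximum $\infty$. A nonempty interval $J\subseteq\mathbb{R}$ with endpoints $a\le b$ in $\overline{\mathbb{R}}$ is represented by $(\mathcal{B}(J),\mathcal{D}(J))\in\mathbb{E}^2$, where $\mathcal{B}(J)=-\infty$ if $a=-\infty$, $a^-$ if $J$ is left closed, $a^+$ if $J$ is left open; $\mathcal{D}(J)=\infty$ if $b=\infty$, $b^-$ if $J$ is right open, $b^+$ if $J$ is right closed. For $d_1<d_2$, $\langle d_1,d_2\rangle$ is the interval represented by $(d_1,d_2)$; also $\langle-\infty,-\infty\rangle=\langle\infty,\infty\rangle=\emptyset$. Every PFD persistence module is a direct sum of interval modules $I_J$ ($\mathsf{k}$ on the interval $J$, $0$ elsewhere, identity maps within $J$), uniquely up to reindexing; $\mathbf{PD}(V)\subset\mathbb{E}\times\mathbb{E}\times\mathbb{N}$ consists of the points $[\mathcal{B}(J),\mathcal{D}(J),k]$, $k=1,\dots,m(I_J)$, for each $J$ occurring in the decomposition of $V$ with multiplicity $m(I_J)$. A matching $\mathcal{X}\colon S\nrightarrow T$ is a relation that is the graph of an injective function $S'\to T'$, $S'\subseteq S$, $T'\subseteq T$; $\mathcal{X}(s)=t$ means $(s,t)\in\mathcal{X}$; points outside the domain/image of this function are unmatched. For $A,B\subseteq\mathbb{R}$: $A\lhd B$ means for all $y\in B$ there is $x\in A$ with $x\le y$; $A\blacktriangleleft B$ means for all $x\in A$ there is $y\in B$ with $x\le y$. For a translation map $\rho$, an interval $J$ is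 $\rho$-trivial if $J\cap\rho(J)=\emptyset$, and $[b,d,i]$ is $\rho$-trivial if $\langle b,d\rangle$ is. Property (P) of a matching $\mathcal{X}\colon\mathbf{PD}(V)\nrightarrow\mathbf{PD}(W)$: whenever $\mathcal{X}([b,d,i])=[b',d',i']$, one has $(\sigma\circ\tau)^{-1}(\langle b,d\rangle)\blacktriangleleft\tau^{-1}(\langle b',d'\rangle)$; $\tau^{-1}(\langle b',d'\rangle)\lhd\langle b,d\rangle$, $\tau^{-1}(\langle b',d'\rangle)\blacktriangleleft\langle b,d\rangle$ and $\tau^{-1}(\langle b',d'\rangle)\cap\langle b,d\rangle\neq\emptyset$; and $\langle b,d\rangle\lhd(\sigma\circ\tau)(\tau^{-1}(\langle b',d'\rangle))$; moreover every unmatched point of $\mathbf{PD}(V)$ is $(\sigma\circ\tau)$-trivial, and every unmatched $[b',d',i']\in\mathbf{PD}(W)$ satisfies $\langle b',d'\rangle\cap\operatorname{im}\tau=\emptyset$ or $\tau^{-1}(\langle b',d'\rangle)$ is $(\sigma\circ\tau)$-trivial. For a monotone $\sigma\colon\mathbb{R}\to\mathbb{R}$, the functions $\sigma^\uparrow,\sigma^\star\colon\mathbb{E}\to\mathbb{E}$ are determined by $\langle\sigma^\uparrow(e),\infty\rangle={\uparrow}\sigma(\langle e,\infty\rangle)$ and $\langle-\infty,\sigma^\star(e)\rangle=\sigma^{-1}(\langle-\infty,e\rangle)$ (equivalently $\langle\sigma^\star(e),\infty\rangle=\sigma^{-1}(\langle e,\infty\rangle)$), where ${\uparrow}S=\{x\in\mathbb{R}:\exists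 y\in S,\ y\le x\}$. *)

(* Defs.v *)
From HB Require Import structures.
From mathcomp Require Import all_boot all_order all_algebra.
From mathcomp Require Import all_classical all_reals.
Set Implicit Arguments.
Unset Strict Implicit.
Unset Printing Implicit Defensive.
Import Order.TTheory GRing.Theory Num.Theory.
Local Open Scope classical_set_scope.
Local Open Scope ring_scope.

(** * Persistence modules *)

Record persmod (R : realType) (k : fieldType) := PersMod {
  pm_sp :> R -> lmodType k;
  pm_map : forall s t : R, s <= t -> {linear pm_sp s -> pm_sp t};
  pm_map_id : forall (t : R) (tt : t <= t) v, pm_map tt v = v;
  pm_map_comp : forall (r s t : R) (rs : r <= s) (st : s <= t) (rt : r <= t) v,
    pm_map st (pm_map rs v) = pm_map rt v }.

Definition PFD (R : realType) (k : fieldType) (V : persmod R k) : Prop :=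
  forall t, exists (n : nat) (f : {linear V t -> 'rV[k]_n}), bijective f.

Record pmhom (R : realType) (k : fieldType) (V W : persmod R k) := PMHom {
  pmhom_fun :> forall t : R, {linear V t -> W t};
  pmhom_comm : forall (s t : R) (st : s <= t) v,
    pmhom_fun t (pm_map V st v) = pm_map W st (pmhom_fun s v) }.

Definition pm_shift (R : realType) (k : fieldType) (V : persmod R k)
    (sigma : R -> R) (hsigma : {homo sigma : x y / x <= y}) : persmod R k :=
  @PersMod R k (fun t => V (sigma t))
    (fun s t st => pm_map V (hsigma s t st))
    (fun t tt v => pm_map_id (hsigma t t tt) v)
    (fun r s t rs st rt v =>
       pm_map_comp (hsigma r s rs) (hsigma s t st) (hsigma r t rt) v).

(** * Interleavings *)

Definition translation_map (R : realType) (sigma : R -> R) : Prop :=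
  {homo sigma : x y / x <= y} /\ (forall x, x <= sigma x).

Record translation_pair (R : realType) (tau sigma : R -> R) : Prop :=
  TranslationPair {
    tp_tau : {homo tau : x y / x <= y};
    tp_sigma : {homo sigma : x y / x <= y};
    tp_st : translation_map (sigma \o tau);
    tp_ts : translation_map (tau \o sigma) }.

Definition interleaved (R : realType) (k : fieldType) (tau sigma : R -> R)
    (tp : translation_pair tau sigma) (V W : persmod R k) : Prop :=
  exists (phi : pmhom V (pm_shift W (tp_tau tp)))
         (psi : pmhom W (pm_shift V (tp_sigma tp))),
    (forall t v, psi (tau t) (phi t v) = pm_map V ((tp_st tp).2 t) v) /\
    (forall t w, phi (sigma t) (psi t w) = pm_map W ((tp_ts tp).2 t) w).

(** * Decorated points and intervals *)

(* [itv_bound R] is the set of decorated points: [BLeft a] is a^-, [BRight a]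
   is a^+, [-oo%O] and [+oo%O] are the extreme elements, and the order of
   [itv_bound R] is the lexicographic one.  For d1 < d2, [Interval d1 d2] is
   the nonempty interval represented by (d1, d2), and every nonempty interval
   of R arises from exactly one such pair. *)
Definition dec_itv (R : realType) (d1 d2 : itv_bound R) : set R :=
  [set` Interval d1 d2].

(** * Interval modules and persistence diagrams *)

Section IntervalModule.
Variables (R : realType) (k : fieldType) (J : interval R).

(* k^1 on J and k^0 = 0 elsewhere; [pid_mx 1] is the identity matrix when both
   dimensions are 1, and the only possible map otherwise. *)
Let sp (t : R) : lmodType k := 'rV[k]_(nat_of_bool (t \in J)).

Let mp (s t : R) (_ : s <= t) : {linear sp s -> sp t} :=
  mulmxr (pid_mx 1 : 'M[k]_(nat_of_bool (s \in J), nat_of_bool (t \in J))).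

Let mp_id (t : R) (tt : t <= t) v : mp tt v = v.
Proof.
rewrite /mp /=; move: v; rewrite /sp; case: (t \in J) => v.
  by rewrite pid_mx_1 mulmx1.
by rewrite [LHS]thinmx0 [RHS]thinmx0.
Qed.

Let mp_comp (r s t : R) (rs : r <= s) (st : s <= t) (rt : r <= t) v :
  mp st (mp rs v) = mp rt v.
Proof.
have : r \in J -> t \in J -> s \in J.
  case: J => a b /andP[ar _] /andP[_ tb]; apply/andP; split.
    by apply: le_trans ar _; rewrite bnd_simp.
  by apply: le_trans tb; rewrite bnd_simp.
rewrite /mp /=; move: v; rewrite /sp.
case: (r \in J); case: (t \in J) => v.
- by move=> -> //; rewrite !pid_mx_1 !mulmx1.
- by move=> _; rewrite [LHS]thinmx0 [RHS]thinmx0.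
- by move=> _; rewrite [v]thinmx0 !mul0mx.
- by move=> _; rewrite [LHS]thinmx0 [RHS]thinmx0.
Qed.

Definition interval_module : persmod R k := PersMod mp_id mp_comp.

End IntervalModule.

(* V is isomorphic to the direct sum of the family M: every vector of V_t is
   the sum of the images of a unique finitely supported family. *)
Definition is_direct_sum (R : realType) (k : fieldType) (I : choiceType)
    (M : I -> persmod R k) (V : persmod R k) : Prop :=
  exists iota : forall i, pmhom (M i) V, forall (t : R) (v : V t),
    exists! x : (forall i, M i t),
      finite_set [set i | x i != 0] /\
      v = \sum_(i \in [set: I]) iota i t (x i).

(* A point [b, d, i] of a persistence diagram is encoded as (b, d, i). *)
Definition dpoint (R : realType) : Type :=
  (itv_bound R * itv_bound R * nat)%type.

Definition diagram (R : realType) (m : itv_bound R -> itv_bound R -> nat) :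
    set (dpoint R) :=
  [set p | (p.1.1 < p.1.2)%O /\ (1 <= p.2 <= m p.1.1 p.1.2)%N].

(* V is isomorphic to the direct sum over all intervals J = <b, d> of
   [m b d] copies of I_J. *)
Definition decomposes (R : realType) (k : fieldType) (V : persmod R k)
    (m : itv_bound R -> itv_bound R -> nat) : Prop :=
  is_direct_sum
    (fun p : diagram m =>
       interval_module k (Interval (val p).1.1 (val p).1.2)) V.

(* For a PFD module the multiplicities exist, and their values on the pairs
   b < d are unique. *)
Definition PD (R : realType) (k : fieldType) (V : persmod R k) :
    set (dpoint R) :=
  [set p | exists2 m, decomposes V m & diagram m p].

(** * Matchings *)

Definition is_matching (P Q : Type) (S : set P) (T : set Q) (X : set (P * Q)) :
    Prop :=
  exists (S' : set P) (T' : set Q) (f : P -> Q),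
    [/\ S' `<=` S, T' `<=` T, set_fun S' T' f, set_inj S' f &
        X = [set (s, f s) | s in S']].

Definition unmatched_src (P Q : Type) (S : set P) (X : set (P * Q)) : set P :=
  [set s | S s /\ ~ (exists t, X (s, t))].

Definition unmatched_tgt (P Q : Type) (T : set Q) (X : set (P * Q)) : set Q :=
  [set t | T t /\ ~ (exists s, X (s, t))].

(** * Property (P) *)

Definition lhd (R : realType) (A B : set R) : Prop :=
  forall y, B y -> exists2 x, A x & x <= y.

Definition blacklhd (R : realType) (A B : set R) : Prop :=
  forall x, A x -> exists2 y, B y & x <= y.

Definition trivial_set (R : realType) (rho : R -> R) (J : set R) : Prop :=
  J `&` rho @` J = set0.

Record propertyP (R : realType) (k : fieldType) (tau sigma : R -> R)
    (V W : persmod R k) (X : set (dpoint R * dpoint R)) : Prop := PropertyP {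
  propP_matched : forall b d i b' d' i', X ((b, d, i), (b', d', i')) ->
    [/\ blacklhd ((sigma \o tau) @^-1` dec_itv b d) (tau @^-1` dec_itv b' d'),
        lhd (tau @^-1` dec_itv b' d') (dec_itv b d),
        blacklhd (tau @^-1` dec_itv b' d') (dec_itv b d),
        tau @^-1` dec_itv b' d' `&` dec_itv b d !=set0 &
        lhd (dec_itv b d) ((sigma \o tau) @` (tau @^-1` dec_itv b' d'))];
  propP_src : forall b d i, unmatched_src (PD V) X (b, d, i) ->
    trivial_set (sigma \o tau) (dec_itv b d);
  propP_tgt : forall b' d' i', unmatched_tgt (PD W) X (b', d', i') ->
    dec_itv b' d' `&` range tau = set0 \/
    trivial_set (sigma \o tau) (tau @^-1` dec_itv b' d') }.

(** * The maps induced on decorated points *)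

Definition upclosure (R : realType) (S : set R) : set R :=
  [set x | exists2 y, S y & y <= x].

(* [xget] picks the element determined by the equation; see [up_mapP] and
   [star_mapP] for its existence and [dec_itvy_inj], [dec_itvNy_inj] for its
   uniqueness. *)
Definition up_map (R : realType) (sigma : R -> R) (e : itv_bound R) :
    itv_bound R :=
  xget -oo%O [set e' | dec_itv e' +oo%O = upclosure (sigma @` dec_itv e +oo%O)].

Definition star_map (R : realType) (sigma : R -> R) (e : itv_bound R) :
    itv_bound R :=
  xget -oo%O [set e' | dec_itv -oo%O e' = sigma @^-1` dec_itv -oo%O e].

Section InducedMaps.
Variable R : realType.
Implicit Types (e : itv_bound R) (x y : R).

Lemma dec_itvyE e x : dec_itv e +oo%O x = (e <= BLeft x)%O :> Prop.
Proof. by rewrite /dec_itv /= itv_boundlr; case: e => [[] a|[]]; rewrite !bnd_simp ?andbT. Qed.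

Lemma dec_itvNyE e x : dec_itv -oo%O e x = (BRight x <= e)%O :> Prop.
Proof. by []. Qed.

Lemma dec_itvC e : dec_itv -oo%O e = ~` dec_itv e +oo%O.
Proof.
apply/seteqP; split => x; rewrite /setC /= dec_itvyE dec_itvNyE.
  by case: e => [[] a|[]]; rewrite !bnd_simp //= => h; apply/negP; rewrite -?ltNge -?leNgt.
by case: e => [[] a|[]]; rewrite !bnd_simp //= => /negP; rewrite -?ltNge -?leNgt.
Qed.

Lemma upset_dec (U : set R) : (forall x y, U x -> x <= y -> U y) ->
  exists e, dec_itv e +oo%O = U.
Proof.
move=> upU; have [U0|/set0P[u Uu]] := eqVneq U set0.
  by exists +oo%O; rewrite U0; apply/seteqP; split=> x //; rewrite dec_itvyE.
have [lbU|nlb] := pselect (has_lbound U); last first.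
  exists -oo%O; apply/seteqP; split=> x; rewrite dec_itvyE //= => _.
  apply: contrapT => nUx; apply: nlb; exists x => y Uy.
  by rewrite leNgt; apply/negP => /ltW yx; apply: nUx; exact: upU yx.
have infU x : inf U < x -> U x.
  by move=> /(inf_lt (ex_intro _ u Uu))[y Uy /ltW]; exact: upU.
have [Ui|nUi] := pselect (U (inf U)).
  exists (BLeft (inf U)); apply/seteqP; split=> x; rewrite dec_itvyE bnd_simp.
    exact: upU.
  exact: ge_inf.
exists (BRight (inf U)); apply/seteqP; split=> x; rewrite dec_itvyE bnd_simp.
  exact: infU.
move=> Ux; rewrite lt_neqAle (ge_inf lbU Ux) andbT.
by apply/eqP => E; apply: nUi; rewrite E.
Qed.

Lemma le_dec_itvy e1 e2 :
  dec_itv e2 +oo%O `<=` dec_itv e1 +oo%O -> (e1 <= e2)%O.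
Proof.
move=> sub; rewrite leNgt; apply/negP => lt21.
suff [x] : exists x, (e2 <= BLeft x)%O /\ ~~ (e1 <= BLeft x)%O.
  by move=> [h1 /negP]; apply; rewrite -dec_itvyE; apply: sub; rewrite dec_itvyE.
move: {sub} lt21; case: e1 => [[] a|[]]; case: e2 => [[] b|[]] //; rewrite !bnd_simp.
- by move=> ba; exists b; rewrite !bnd_simp -ltNge.
- move=> ba; exists ((b + a) / 2).
  by rewrite !bnd_simp -ltNge midf_lt// midf_lt.
- by move=> _; exists (a - 1); rewrite !bnd_simp -ltNge ltrBlDr ltrDl ltr01.
- by move=> ba; exists b; rewrite !bnd_simp -?leNgt.
- by move=> ba; exists a; rewrite !bnd_simp -?leNgt ?ltxx.
- by move=> _; exists a; rewrite !bnd_simp -?leNgt ?ltxx.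
- by move=> _; exists b; rewrite !bnd_simp.
- by move=> _; exists (b + 1); rewrite !bnd_simp ltrDl ltr01.
- by move=> _; exists 0.
Qed.

Lemma dec_itvy_inj e1 e2 : dec_itv e1 +oo%O = dec_itv e2 +oo%O -> e1 = e2.
Proof.
by move=> E; apply/le_anti/andP; split; apply: le_dec_itvy; rewrite E.
Qed.

Lemma dec_itvNy_inj e1 e2 : dec_itv -oo%O e1 = dec_itv -oo%O e2 -> e1 = e2.
Proof. by rewrite !dec_itvC => /setC_inj /dec_itvy_inj. Qed.

Variable sigma : R -> R.

Lemma up_mapP e :
  dec_itv (up_map sigma e) +oo%O = upclosure (sigma @` dec_itv e +oo%O).
Proof.
rewrite /up_map; case: xgetP => [//|H].
have [e' E] : exists e', dec_itv e' +oo%O = upclosure (sigma @` dec_itv e +oo%O).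
  by apply: upset_dec => x y [z Sz zx] xy; exists z => //; exact: le_trans xy.
by case: (H e' E).
Qed.

Hypothesis sigma_homo : {homo sigma : x y / x <= y}.

Let star_map_ex e :
  exists e', dec_itv e' +oo%O = sigma @^-1` dec_itv e +oo%O.
Proof.
apply: upset_dec => x y; rewrite /preimage /= !dec_itvyE => ex xy.
by apply: le_trans ex _; rewrite bnd_simp; exact: sigma_homo.
Qed.

Lemma star_mapP e :
  dec_itv -oo%O (star_map sigma e) = sigma @^-1` dec_itv -oo%O e.
Proof.
rewrite /star_map; case: xgetP => [//|H].
have [e' E] := star_map_ex e.
by case: (H e'); rewrite /= !dec_itvC E.
Qed.

Lemma star_mapPy e :
  dec_itv (star_map sigma e) +oo%O = sigma @^-1` dec_itv e +oo%O.
Proof.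
by apply: setC_inj; rewrite -dec_itvC star_mapP dec_itvC.
Qed.

End InducedMaps.

(* Main.v *)
Require Import Defs.
From mathcomp Require Import all_boot all_order all_algebra.
From mathcomp Require Import all_classical all_reals.
Set Implicit Arguments.
Unset Strict Implicit.
Unset Printing Implicit Defensive.
Import Order.TTheory GRing.Theory Num.Theory.
Local Open Scope classical_set_scope.
Local Open Scope ring_scope.

(** Every interval <b, d> is the intersection of the up-set <b, oo> with the
    down-set <-oo, d>, and e1 <= e2 holds in the order of decorated points as
    soon as <e2, oo> is included in <e1, oo>.  Each inequality is therefore an
    inclusion of up-sets, or of the complementary down-sets.  Write
    J = <b, d>, J' = <b', d'> and K = tau^-1 J'.  The comparisons in property
    (P) give these inclusions at the points of J, of K, or of the preimage of
    J under sigma o tau; monotonicity extends them to the whole up-sets or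
    down-sets, because J and K share a point u.  The inequality
    sigma^star d <= tau^up (tau^star d') also uses that sigma o tau is a
    translation map: if tau w lies in <d', oo>, then w >= u, so that
    u <= sigma (tau u) <= sigma (tau w) puts sigma (tau w) in <b, oo>, and if
    it were also in <-oo, d> then property (P) would bound w by a point of K,
    putting tau w in <-oo, d'>, which is absurd.

    When tau is onto, tau^up (tau^star e) = e, as tau (tau^-1 S) = S; and any
    common point of J' and tau (sigma J') is the image under tau of a common
    point of K and sigma (tau K), so triviality passes from K to J'.  If J'
    misses the image of tau, then it is empty. *)

Section DecoratedIntervals.
Variable R : realType.
Implicit Types (e b d : itv_bound R) (x y : R).

Lemma dec_itvI b d : dec_itv b d = dec_itv b +oo%O `&` dec_itv -oo%O d.
Proof.
apply/seteqP; split=> x; rewrite /setI /= dec_itvyE dec_itvNyE.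
  by move=> /andP[].
by move=> [bx xd]; apply/andP.
Qed.

Lemma dec_itvy_up e x y : x <= y -> dec_itv e +oo%O x -> dec_itv e +oo%O y.
Proof.
by move=> xy; rewrite !dec_itvyE => /le_trans; apply; rewrite bnd_simp.
Qed.

Lemma dec_itvNy_down e x y :
  x <= y -> dec_itv -oo%O e y -> dec_itv -oo%O e x.
Proof. by move=> xy; rewrite !dec_itvNyE; apply: le_trans; rewrite bnd_simp. Qed.

Lemma dec_itvy_or_Ny e x : dec_itv e +oo%O x \/ dec_itv -oo%O e x.
Proof. by rewrite dec_itvC; exact: EM. Qed.

Lemma dec_itv_disjoint e x : dec_itv e +oo%O x -> ~ dec_itv -oo%O e x.
Proof. by rewrite dec_itvC; move=> ex; apply. Qed.

Lemma dec_itvNy_le_dec_itvy e x y :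
  dec_itv -oo%O e x -> dec_itv e +oo%O y -> x <= y.
Proof.
move=> xe ey; rewrite leNgt; apply/negP => /ltW yx.
exact: dec_itv_disjoint (dec_itvy_up yx ey) xe.
Qed.

End DecoratedIntervals.

Section MatchedPoints.
Variables (R : realType) (tau sigma : R -> R).
Hypothesis tau_homo : {homo tau : x y / x <= y}.
Hypothesis sigma_homo : {homo sigma : x y / x <= y}.
Variables b d b' d' : itv_bound R.
Let J := dec_itv b d.
Let K := tau @^-1` dec_itv b' d'.

Lemma star_birth_le : J !=set0 -> lhd K J -> (star_map tau b' <= b)%O.
Proof.
move=> [j Jj] KJ; apply: le_dec_itvy => y yb.
rewrite (star_mapPy tau_homo) /preimage /=.
suff [x Kx xy] : exists2 x, K x & x <= y.
  move: Kx; rewrite /K dec_itvI => -[bx _].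
  exact: dec_itvy_up (tau_homo xy) bx.
have [yd|yd] := dec_itvy_or_Ny d y; last by apply: KJ; rewrite /J dec_itvI.
have [x Kx xj] := KJ _ Jj; exists x => //; apply: (le_trans xj).
by move: Jj; rewrite /J dec_itvI => -[_ jd]; exact: dec_itvNy_le_dec_itvy jd yd.
Qed.

Lemma star_death_le : K !=set0 -> blacklhd K J -> (star_map tau d' <= d)%O.
Proof.
move=> [u Ku] KJ.
have b'u : dec_itv b' +oo%O (tau u) by move: Ku; rewrite /K dec_itvI => -[].
apply: le_dec_itvy => x xd.
rewrite (star_mapPy tau_homo) /preimage /=.
have [//|xd'] := dec_itvy_or_Ny d' (tau x); exfalso.
suff [y + xy] : exists2 y, J y & x <= y.
  by rewrite /J dec_itvI => -[_ /(dec_itvNy_down xy)]; exact: dec_itv_disjoint.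
have [xu|/ltW ux] := leP x u.
  by have [y Jy uy] := KJ _ Ku; exists y => //; exact: le_trans uy.
apply: KJ; rewrite /K dec_itvI; split => //.
exact: dec_itvy_up (tau_homo ux) b'u.
Qed.

(** To compare a decorated point with [up_map tau (star_map tau e)] it is
    enough to look at the images under tau of the points of
    [tau @^-1` <e, oo>]. *)
Lemma star_le_up_star (a e : itv_bound R) :
  (forall w, dec_itv e +oo%O (tau w) -> dec_itv a +oo%O (sigma (tau w))) ->
  (star_map sigma a <= up_map tau (star_map tau e))%O.
Proof.
move=> H; apply: le_dec_itvy => z.
rewrite up_mapP (star_mapPy tau_homo) (star_mapPy sigma_homo).
move=> [_ [w ew <-] wz]; rewrite /preimage /=.
exact: dec_itvy_up (sigma_homo wz) (H _ ew).
Qed.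

Lemma star_birth_le_up_star : K !=set0 -> lhd J ((sigma \o tau) @` K) ->
  (star_map sigma b <= up_map tau (star_map tau b'))%O.
Proof.
move=> [u Ku] JK; apply: star_le_up_star => w bw.
suff [v Kv vw] : exists2 v, K v & v <= w.
  have [|x + xv] := JK ((sigma \o tau) v); first by exists v.
  rewrite /J dec_itvI => -[bx _]; apply: dec_itvy_up bx.
  exact: le_trans xv (sigma_homo (tau_homo vw)).
have [uw|/ltW wu] := leP u w; first by exists u.
exists w => //; move: Ku; rewrite /K dec_itvI => -[_ ud]; split=> //.
exact: dec_itvNy_down (tau_homo wu) ud.
Qed.

Lemma star_death_le_up_star : (forall x, x <= sigma (tau x)) ->
  K `&` J !=set0 -> blacklhd ((sigma \o tau) @^-1` J) K ->
  (star_map sigma d <= up_map tau (star_map tau d'))%O.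
Proof.
move=> st_ge [u [Ku Ju]] JK; apply: star_le_up_star => w dw.
have [//|wd] := dec_itvy_or_Ny d (sigma (tau w)); exfalso.
(* Since tau w lies in <d', oo>, every point of K is strictly below w. *)
have Kw y : K y -> ~ w <= y.
  rewrite /K dec_itvI => -[_ yd] wy; apply: dec_itv_disjoint dw _.
  exact: dec_itvNy_down (tau_homo wy) yd.
have uw : u <= w by rewrite leNgt; apply/negP => /ltW; exact: Kw.
have [|y /Kw //] := JK w.
rewrite /J dec_itvI; split=> //.
move: Ju; rewrite /J dec_itvI => -[bu _]; apply: dec_itvy_up bu.
exact: le_trans (st_ge u) (sigma_homo (tau_homo uw)).
Qed.

Lemma up_map_star_map (e : itv_bound R) : (forall y, exists x, tau x = y) ->
  up_map tau (star_map tau e) = e.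
Proof.
move=> tau_surj; apply: dec_itvy_inj.
rewrite up_mapP (star_mapPy tau_homo); apply/seteqP; split=> z.
  by move=> [_ [w ew <-] wz]; exact: dec_itvy_up wz ew.
by have [x <-] := tau_surj z => ex; exists (tau x) => //; exists x.
Qed.

End MatchedPoints.

Lemma trivial_set_preimage (R : realType) (tau sigma : R -> R) (S : set R) :
  (forall y, exists x, tau x = y) ->
  trivial_set (sigma \o tau) (tau @^-1` S) -> trivial_set (tau \o sigma) S.
Proof.
move=> tau_surj KK; rewrite /trivial_set -subset0 => x [+ [y Sy E]].
rewrite -E => Sx.
have [w Ew] := tau_surj y; rewrite -Ew /= in Sx Sy.
have : (tau @^-1` S `&` (sigma \o tau) @` (tau @^-1` S)) (sigma (tau w)).
  by split => //; exists w.
by rewrite KK.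
Qed.

Theorem corollary4p4 (R : realType) (k : fieldType) (V W : persmod R k)
    (tau sigma : R -> R) (tp : translation_pair tau sigma)
    (pfdV : PFD V) (pfdW : PFD W) (hVW : interleaved tp V W)
    (X : set (dpoint R * dpoint R)) (hX : is_matching (PD V) (PD W) X)
    (hP : propertyP tau sigma V W X) :
  (forall b d i b' d' i', X ((b, d, i), (b', d', i')) ->
    [/\ (star_map tau b' <= b)%O,
        (star_map tau d' <= d)%O,
        (star_map sigma b <= (up_map tau \o star_map tau) b')%O &
        (star_map sigma d <= (up_map tau \o star_map tau) d')%O]) /\
  (bijective tau -> bijective sigma ->
    [/\ forall b d i b' d' i', X ((b, d, i), (b', d', i')) ->
          [/\ (star_map tau b' <= b)%O,
              (star_map tau d' <= d)%O,
              (star_map sigma b <= b')%O &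
              (star_map sigma d <= d')%O],
        forall b d i, unmatched_src (PD V) X (b, d, i) ->
          trivial_set (sigma \o tau) (dec_itv b d) &
        forall b' d' i', unmatched_tgt (PD W) X (b', d', i') ->
          trivial_set (tau \o sigma) (dec_itv b' d')]).
Proof.
have tau_homo := tp_tau tp; have sigma_homo := tp_sigma tp.
have matched b d i b' d' i' : X ((b, d, i), (b', d', i')) ->
    [/\ (star_map tau b' <= b)%O, (star_map tau d' <= d)%O,
        (star_map sigma b <= up_map tau (star_map tau b'))%O &
        (star_map sigma d <= up_map tau (star_map tau d'))%O].
  move=> /(propP_matched hP)[P1 P2 P3 P4 P5]; have [u [Ku Ju]] := P4.
  split.
  - by apply: (star_birth_le tau_homo _ P2); exists u.
  - by apply: (star_death_le tau_homo _ P3); exists u.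
  - by apply: (star_birth_le_up_star tau_homo sigma_homo _ P5); exists u.
  - exact: (star_death_le_up_star tau_homo sigma_homo (tp_st tp).2 P4 P1).
split=> [//|[g _ gK] _].
have tau_surj y : exists x, tau x = y by exists (g y).
split.
- move=> b d i b' d' i' /matched[h1 h2].
  by rewrite !(up_map_star_map tau_homo) => // h3 h4; split.
- exact: propP_src hP.
- move=> b' d' i' /(propP_tgt hP)[J0|]; last exact: trivial_set_preimage.
  rewrite /trivial_set -subset0 => x [Jx _]; rewrite -J0; split => //.
  by have [w <-] := tau_surj x; exists w.
Qed.
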